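(* For every $n \geq 2^{20}$, there exists a graph $G$ on $n$ vertices with at least one universal vertex such that the mode of the domination polynomial $D(G,x)$ is at least $n/2 + \frac{1}{999}\log_2 n$.
   Context: All graphs are finite, undirected and simple. For a graph $G=(V,E)$ on $n$ vertices and $S \subseteq V$, the (closed) neighborhood $N(S)$ is the set of vertices that are either in $S$ or adjacent to a vertex of $S$. A set $S$ is dominating if $N(S)=V$. Let $d_i(G)$ be the number of $i$-element dominating vertex sets of $G$; the domination polynomial is $D(G,x)=\sum_{i=1}^n d_i(G)x^i$. A vertex $v$ is universal if it is adjacent to every other vertex. A polynomial $f(x)=\sum_{i=0}^n a_i x^i$ is unimodal if there is $k\in[0,n]$ with $a_i \le a_{i+1}$ for all $i<k$ and $a_i \ge a_{i+1}$ for all $i \ge k$; the largest such $k$ is called the mode of $f$. (For $n \ge 2^{13}$, every graph on $n$ vertices with a universal vertex has unimodal domination polynomial, so the mode is defined.) *)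

(* Defs.v *)
From mathcomp Require Import all_boot all_order all_algebra.

Set Implicit Arguments.
Unset Strict Implicit.
Unset Printing Implicit Defensive.

Import Order.TTheory GRing.Theory Num.Theory.
Local Open Scope ring_scope.

Record simple_graph (T : finType) := SimpleGraph {
  adj :> rel T;
  adj_sym : symmetric adj;
  adj_irrefl : irreflexive adj }.

Definition closed_nbhd (T : finType) (G : simple_graph T) (S : {set T}) :
    {set T} :=
  [set v | (v \in S) || [exists u in S, G u v]].

Definition dominating (T : finType) (G : simple_graph T) (S : {set T}) : bool :=
  closed_nbhd G S == [set: T].

Definition dom_count (T : finType) (G : simple_graph T) (i : nat) : nat :=
  #|[set S : {set T} | (#|S| == i) && dominating G S]|.

Definition dom_poly (T : finType) (G : simple_graph T) : {poly int} :=
  \sum_(1 <= i < #|T|.+1) (dom_count G i)%:R *: 'X^i.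

Definition universal (T : finType) (G : simple_graph T) (v : T) : Prop :=
  forall u : T, u != v -> G v u.

(* The index k lies in [0, deg p]; comparisons p`_i versus p`_i.+1 are made
   only between coefficients of index at most deg p = (size p).-1. *)
Definition unimodal_at (R : numDomainType) (p : {poly R}) (k : nat) : Prop :=
  [/\ (k <= (size p).-1)%N,
      forall i : nat, (i < k)%N -> p`_i <= p`_i.+1
    & forall i : nat, (k <= i < (size p).-1)%N -> p`_i.+1 <= p`_i].

(* In particular, is_mode p k entails that p is unimodal. *)
Definition is_mode (R : numDomainType) (p : {poly R}) (k : nat) : Prop :=
  unimodal_at p k /\ forall j : nat, unimodal_at p j -> (j <= k)%N.

(* Main.v *)
Require Import Defs.
From mathcomp Require Import all_boot all_order all_algebra.
From mathcomp Require Import zify ring lra.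
From mathcomp Require Import reals exp.

(** The graph is a universal vertex joined to 2^s disjoint cliques of size s
    and one large clique of size b, where s is about (log_2 n)/5. With
    M = s 2^s, p = ((1+X)^s - 1)^(2^s) and q = X (1+X)^M + p, the domination
    polynomial is q (1+X)^b - p, and p has degree at most M < b/2. Conditioning
    on meeting every small clique shifts the mean of p/p(1) to about M/2 + s/2,
    and p(1)/2^M is about 1/e, so the mean of q/q(1) exceeds M/2 by a multiple
    of s. Since the binomial coefficients of (1+X)^b are nearly constant within
    distance O(M) of b/2, the mode of q (1+X)^b lies near b/2 plus that mean.
    Unimodality holds because the coefficients increase up to b/2, decrease from
    b/2 + M + 1 on, and are concave in between, as C(b, l)
    is concave in l for |2l - b| <= sqrt(b). *)

Import Order.TTheory GRing.Theory Num.Theory.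
Local Open Scope ring_scope.

(** * Generating functions of all sets and of hitting sets *)

Lemma sum_set_prod (R : comNzRingType) (T : finType) (w : T -> R) :
  \sum_(S : {set T}) \prod_(x in S) w x = \prod_x (w x + 1).
Proof.
rewrite bigA_distr; apply: eq_bigr => S _.
by rewrite big_mkcond.
Qed.

(** Inclusion-exclusion over sets [J] of missed colours: expand the product of [1 - miss S c],
    exchange the sums, and apply [sum_set_prod] with the weights of colours in [J] set to zero. *)
Lemma sum_hitting_set_prod (R : comNzRingType) (T C : finType) (f : T -> C)
    (w : T -> R) :
  \sum_(S : {set T} | [forall c, [exists x in S, f x == c]]) \prod_(x in S) w x
  = \prod_c (\prod_(x | f x == c) (w x + 1) - 1).
Proof.
pose miss (S : {set T}) c : R := ([forall x in S, f x != c])%:R.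
transitivity (\sum_(S : {set T}) (\prod_c (- miss S c + 1)) * \prod_(x in S) w x).
  rewrite big_mkcond; apply: eq_bigr => S _.
  case: ifPn => [/forallP hS|].
    suff -> : \prod_c (- miss S c + 1) = 1 by rewrite mul1r.
    apply: big1 => c _; rewrite /miss.
    have [x xS /eqP fx] := exists_inP (hS c).
    suff -> : [forall x in S, f x != c] = false by rewrite oppr0 add0r.
    by apply/negbTE/forall_inPn; exists x; rewrite // negbK fx.
  rewrite negb_forall => /existsP [c hc].
  rewrite (bigD1 c) //= /miss.
  suff -> : [forall x in S, f x != c] by rewrite addNr !mul0r.
  by move: hc; rewrite negb_exists_in.
have step S : (\prod_c (- miss S c + 1)) * \prod_(x in S) w x =
    \sum_(J : {set C}) (-1) ^+ #|J| *
       \prod_(x in S) (w x * (f x \notin J)%:R).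
  rewrite bigA_distr mulr_suml; apply: eq_bigr => J _.
  rewrite -big_mkcond /= prodrN -mulrA big_split /= [_ * \prod_(_ in S) _%:R]mulrC.
  congr (_ * (_ * _)); rewrite /miss.
  transitivity ([forall x in S, f x \notin J]%:R : R).
    have [/forall_inP h|/forall_inPn [x xS]] := boolP [forall x in S, f x \notin J].
      rewrite big1 // => c cJ; suff -> : [forall x in S, f x != c] by [].
      by apply/forall_inP => x xS; apply: contraNneq (h x xS) => ->.
    rewrite negbK => fJ; rewrite (bigD1 (f x)) //=.
    suff -> : [forall x0 in S, f x0 != f x] = false by rewrite mul0r.
    by apply/negbTE/forall_inPn; exists x; rewrite // negbK.
  have [/forall_inP h|/forall_inPn [x xS]] := boolP [forall x in S, f x \notin J].
    by rewrite big1 // => x xS; rewrite h.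
  by rewrite negbK => fJ; rewrite (bigD1 x) //= fJ mul0r.
rewrite (eq_bigr _ (fun S _ => step S)) exchange_big /=.
rewrite (eq_bigr (fun c => -1 + \prod_(x | f x == c) (w x + 1))) => [|c _]; last first.
  by rewrite addrC.
rewrite bigA_distr; apply: eq_bigr => J _.
rewrite -mulr_sumr sum_set_prod (partition_big f predT) //=.
rewrite -prodr_const big_mkcond -big_split; apply: eq_bigr => c _ /=.
case: ifP => cJ; rewrite ?mul1r.
  by rewrite big1 ?mulr1 // => x /eqP ->; rewrite cJ mulr0 add0r.
by apply: eq_bigr => x /eqP ->; rewrite cJ mulr1.
Qed.

(** * Domination polynomial of a universal vertex over disjoint cliques *)

(** The vertex [v] makes [T] nonempty, so the empty set does not dominate and starting [dom_poly] at
    index 1 loses nothing. *)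
Lemma dom_polyE (T : finType) (G : simple_graph T) (v : T) :
  dom_poly G = \sum_(S | dominating G S) 'X^#|S|.
Proof.
have nz S : dominating G S -> (0 < #|S|)%N.
  rewrite card_gt0 /dominating; apply: contraTneq => ->.
  apply/eqP => /setP /(_ v); rewrite !inE => /existsP [u].
  by rewrite inE.
rewrite [RHS](partition_big (fun S : {set T} => inord #|S| : 'I_#|T|.+1)
  predT) //= big_ord_recl /= [X in X + _]big1 ?add0r => [|S]; last first.
  case/andP => /nz S0 /eqP /(congr1 val); rewrite /= inordK ?ltnS ?max_card //.
  by move: S0 => /[swap] ->.
rewrite /dom_poly big_add1 /= big_mkord; apply: eq_bigr => i _.
rewrite /dom_count scaler_nat -sumr_const; apply: congr_big => // S.
  rewrite !inE andbC; congr (_ && _).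
  by rewrite -val_eqE /= inordK ?ltnS ?max_card.
by rewrite inE => /andP [/eqP ->].
Qed.

Section Cone.
Variables (T C : finType) (v0 : T) (f : T -> C).

Definition cone_adj : rel T :=
  [rel u v | (u != v) && [|| u == v0, v == v0 | f u == f v]].

Lemma cone_adj_sym : symmetric cone_adj.
Proof. by move=> u v; rewrite /cone_adj /= eq_sym [f u == _]eq_sym orbCA. Qed.

Lemma cone_adj_irrefl : irreflexive cone_adj.
Proof. by move=> u; rewrite /cone_adj /= eqxx. Qed.

Definition cone : simple_graph T := SimpleGraph cone_adj_sym cone_adj_irrefl.

Lemma universal_cone : universal cone v0.
Proof. by move=> u uv; rewrite /= /cone_adj /= eq_sym uv eqxx. Qed.

Hypothesis f_surj : forall c, exists2 v, v != v0 & f v = c.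

(** When [v0] is outside [S], a vertex other than [v0] is dominated only from its own clique;
    [f_surj] supplies such a vertex in every clique. *)
Lemma dominating_cone (S : {set T}) :
  dominating cone S = (v0 \in S) || [forall c, [exists x in S, f x == c]].
Proof.
apply/eqP/idP => [/setP domS|].
  have [//|v0S /=] := boolP (v0 \in S); apply/forallP => c.
  have [v vv0 <-] := f_surj c; have := domS v; rewrite !inE.
  case/orP => [vS|/exists_inP [u uS]]; first by apply/exists_inP; exists v.
  rewrite /= /cone_adj /= (negPf vv0) => /andP [_ /orP [/eqP uv0|fuv]].
    by rewrite -uv0 uS in v0S.
  by apply/exists_inP; exists u.
move=> h; apply/setP => v; rewrite !inE.
have [//|vS /=] := boolP (v \in S).
case/orP: h => [v0S|/forallP h].
  apply/exists_inP; exists v0 => //=; rewrite /cone_adj /= eqxx andbT.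
  by apply: contraNneq vS => <-.
have /exists_inP [u uS /eqP fu] := h (f v).
apply/exists_inP; exists u => //=; rewrite /cone_adj /= fu eqxx !orbT andbT.
by apply: contraNneq vS => <-.
Qed.

Lemma dom_poly_cone :
  dom_poly cone = 'X * ('X + 1) ^+ #|T|.-1 +
    \prod_c (\prod_(x | f x == c) ((if x == v0 then 0 else 'X) + 1) - 1).
Proof.
(* Weight 0 at [v0] kills the sets containing it. The sets that do contain [v0] are counted as
   [(X+1)^|T| - (X+1)^(|T|-1)]. *)
pose w (x : T) : {poly int} := if x == v0 then 0 else 'X.
have wS (S : {set T}) : \prod_(x in S) w x = if v0 \in S then 0 else 'X^#|S|.
  case: ifP => v0S; first by rewrite (bigD1 v0) //= /w eqxx mul0r.
  rewrite -prodr_const; apply: eq_bigr => x xS; rewrite /w.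
  by case: eqP => // xv; rewrite -xv xS in v0S.
have T0 : (0 < #|T|)%N by apply/card_gt0P; exists v0.
have prodw : \prod_x (w x + 1) = ('X + 1) ^+ #|T|.-1.
  rewrite (bigD1 v0) //= /w eqxx add0r mul1r.
  rewrite (eq_bigr (fun=> 'X + 1)) => [|x /negPf -> //].
  by rewrite prodr_const cardC1.
rewrite (dom_polyE _ _ v0) -sum_hitting_set_prod.
transitivity (\sum_(S : {set T}) ('X^#|S| : {poly int}) -
    \sum_(S : {set T}) \prod_(x in S) w x +
    \sum_(S : {set T} | [forall c, [exists x in S, f x == c]])
       \prod_(x in S) w x).
  rewrite -sumrB [X in _ + X]big_mkcond -big_split [LHS]big_mkcond /=.
  apply: eq_bigr => S _; rewrite dominating_cone wS.
  by case: (v0 \in S) => /=; case: ifP => _; ring.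
congr (_ + _); rewrite sum_set_prod prodw.
under eq_bigr do rewrite -prodr_const.
by rewrite sum_set_prod prodr_const -[X in _ ^+ X](prednK T0) exprS; ring.
Qed.

End Cone.

Lemma big_ord_interval (R : Type) (idx : R) (op : Monoid.com_law idx)
    (n a c : nat) (F : nat -> R) : (c <= n)%N ->
  \big[op/idx]_(i < n | (a <= i < c)%N) F i = \big[op/idx]_(a <= i < c) F i.
Proof.
move=> cn; rewrite -(big_mkord (fun i => a <= i < c)%N) (big_nat_widenl a 0) //.
by rewrite (big_nat_widen _ c n).
Qed.

Section CliqueCone.
Variables m s b : nat.
Hypotheses (s_gt0 : (0 < s)%N) (b_gt0 : (0 < b)%N).

(* Vertices are cut into m blocks of length s, then a block of length b, then
   the universal vertex ord_max, which has the colour of the last block. *)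
Definition block (i : 'I_(m * s + b).+1) : 'I_m.+1 := inord (minn (i %/ s) m).

Lemma blockE i (c : 'I_m.+1) : (block i == c) =
  (c * s <= i < if c == m :> nat then (m * s + b).+1 else c.+1 * s)%N.
Proof.
rewrite -val_eqE /= inordK ?ltnS ?geq_minr //.
have := ltn_ord i; have := ltn_ord c; have := divn_eq i s.
have := ltn_pmod i s_gt0.
move: (i %/ s)%N (i %% s)%N => q r.
move: (nat_of_ord i) (nat_of_ord c) => j d rs -> dm jn.
by case: (eqVneq d m) => [->|ne]; apply/idP/idP => h; nia.
Qed.

Lemma block_surj c : exists2 i, i != ord_max & block i = c.
Proof.
have cm := ltn_ord c.
have lt : (c * s < (m * s + b).+1)%N by nia.
exists (Ordinal lt); first by rewrite -val_eqE /=; nia.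
by apply/eqP; rewrite blockE /= leqnn /=; case: eqP => _ //; nia.
Qed.

Lemma dom_poly_clique_cone :
  dom_poly (cone _ _ ord_max block) = 'X * ('X + 1) ^+ (m * s + b) +
    (('X + 1) ^+ s - 1) ^+ m * (('X + 1) ^+ b - 1).
Proof.
rewrite (dom_poly_cone _ _ _ _ block_surj) card_ord /=; congr (_ + _).
(* Indexing by position turns colour classes into intervals; the universal vertex, at position
   [m * s + b], gets the factor 1. *)
pose F (i : nat) : {poly int} := (if i == (m * s + b)%N then 0 else 'X) + 1.
have cls (c : 'I_m.+1) :
    \prod_(x | block x == c) ((if x == ord_max then 0 else 'X) + 1) =
    \prod_(c * s <= i < if c == m :> nat then (m * s + b).+1 else (c.+1 * s)%N) F i.
  rewrite -(big_ord_interval _ _ _ (m * s + b).+1).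
    by apply: eq_big => [i|i _]; rewrite ?blockE // /F -val_eqE.
  by have := ltn_ord c; case: eqP => [->|]; nia.
under eq_bigr do rewrite cls.
rewrite big_ord_recr /= eqxx; congr (_ * _).
  rewrite -[m in RHS]card_ord -prodr_const; apply: eq_bigr => i _.
  have im := ltn_ord i.
  rewrite ltn_eqF // (eq_big_nat _ _ (F2 := fun=> 'X + 1)) => [|j hj].
    by rewrite prodr_const_nat mulSn addnK.
  by rewrite /F ltn_eqF //; nia.
rewrite big_nat_recr ?leq_addr //= {2}/F eqxx add0r mulr1.
rewrite (eq_big_nat _ _ (F2 := fun=> 'X + 1)) => [|j hj].
  by rewrite prodr_const_nat addKn.
by rewrite /F ltn_eqF //; lia.
Qed.

End CliqueCone.

(** * Binomial coefficients near the centre *)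

Lemma coefXD1n (b i : nat) : (('X + 1 : {poly int}) ^+ b)`_i = 'C(b, i)%:R.
Proof.
elim: b i => [|b IH] i; first by rewrite expr0 coef1 bin0n.
by rewrite exprS mulrDl mul1r coefD coefXM !IH; case: i => [|i];
  rewrite /= ?bin0 ?add0r // binS natrD addrC.
Qed.

Lemma bin_le_succ b l : (2 * l < b)%N -> ('C(b, l) <= 'C(b, l.+1))%N.
Proof. by move=> h; have := mul_bin_left b l; nia. Qed.

Lemma bin_ge_succ b l : (b <= (2 * l).+1)%N -> ('C(b, l.+1) <= 'C(b, l))%N.
Proof. by move=> h; have := mul_bin_left b l; nia. Qed.

(** With [b = l + c + 2], the outer terms are [(l+1)/(c+2)] and [(c+1)/(l+2)] times the middle one.
    These ratios add up to at most 2 exactly when [(l-c)^2 <= l+c+4], which is the hypothesis. *)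
Lemma bin_concave b l : (l + 2 <= b)%N ->
  ((2 * l.+1)%:Z - b%:Z) ^+ 2 <= (b + 2)%:Z ->
  ('C(b, l) + 'C(b, l.+2) <= 2 * 'C(b, l.+1))%N.
Proof.
move=> lb; have := mul_bin_left b l; have := mul_bin_left b l.+1.
have [c ->] : exists c, b = (l + c.+2)%N by exists (b - l).-2; lia.
move: ('C(_, l)) ('C(_, l.+1)) ('C(_, l.+2)) => x y z.
have -> : (l + c.+2 - l.+1 = c.+1)%N by lia.
have -> : (l + c.+2 - l = c.+2)%N by lia.
move=> hz hx h.
have key : (l.+1 * l.+2 + c.+1 * c.+2 <= 2 * (l.+2 * c.+2))%N by nia.
have : (l.+2 * c.+2 * (x + z) <= l.+2 * c.+2 * (2 * y))%N.
  have -> : (l.+2 * c.+2 * (x + z) = (l.+1 * l.+2 + c.+1 * c.+2) * y)%N by nia.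
  by nia.
by rewrite leq_pmul2l.
Qed.

Lemma bin_le_half N l : (l <= N)%N -> ('C(N, l) <= 'C(N, N./2))%N.
Proof.
wlog hl : l / (N <= 2 * l)%N => [IH lN|].
  have [/IH|h] := leqP N (2 * l); first exact.
  by rewrite -bin_sub //; apply: IH; lia.
have hlN : (uphalf N <= l)%N by lia.
rewrite -{hl}(subnKC hlN); move: (l - _)%N => k {l hlN}.
elim: k => [|k IH] h.
  rewrite addn0 -(@bin_sub N (uphalf N)); last by lia.
  by have -> : (N - uphalf N = N./2)%N by lia.
rewrite addnS; apply: leq_trans (IH _); last by lia.
by apply: bin_ge_succ; lia.
Qed.

(* The binomial coefficient at distance d/2 from N/2 is at least 1 - d^2/(2N)
   times the central one: telescope the differences of neighbours. *)
Lemma bin_flat N l : (l <= N)%N ->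
  (2 * N%:Z - (2 * l%:Z - N%:Z) ^+ 2) * 'C(N, N./2)%:Z <= 2 * N%:Z * 'C(N, l)%:Z.
Proof.
wlog hl : l / (N <= 2 * l)%N => [IH lN|].
  have [/IH|h] := leqP N (2 * l); first exact.
  have := IH (N - l)%N; rewrite bin_sub // => H.
  suff -> : (2 * l%:Z - N%:Z) ^+ 2 = (2 * (N - l)%N%:Z - N%:Z) ^+ 2 by apply: H; lia.
  by rewrite -subzn //; ring.
have hlN : (uphalf N <= l)%N by lia.
rewrite -{hl}(subnKC hlN); move: (l - _)%N => k {l hlN}.
elim: k => [|k IH] h.
  rewrite addn0 -(@bin_sub N (uphalf N)); last by lia.
  have -> : (N - uphalf N = N./2)%N by lia.
  by apply: ler_wpM2r => //; rewrite lerBlDr lerDl sqr_ge0.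
rewrite addnS in h *; have {IH} := IH (ltnW h).
have := bin_le_half N _ (ltnW h); have := mul_bin_left N (uphalf N + k).
have := @bin_ge_succ N (uphalf N + k).
have : (N <= 2 * (uphalf N + k))%N by lia.
move: (uphalf N + k)%N h => j jN Nj.
move: 'C(N, N./2) 'C(N, j) 'C(N, j.+1) => W x y.
have [d NE] : exists d, N = (j + d.+1)%N by exists (N - j.+1)%N; lia.
have -> : (N - j = d.+1)%N by lia.
move=> /(_ ltac:(lia)) yx xy xW H.
have h1 : (N * (x - y) <= 2 * (j - d) * W)%N.
  apply: (@leq_trans (2 * (j.+1 * (x - y)))).
    by rewrite mulnA leq_mul2r; apply/orP; right; lia.
  by rewrite [(j.+1 * _)%N]mulnBr xy -mulnBl subSS mulnA leq_mul.
have h2 : N%:Z * (x%:Z - y%:Z) <= 2 * (j%:Z - d%:Z) * W%:Z.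
  by rewrite !subzn //; lia.
by lia.
Qed.

(** * Modes of sequences that rise, are concave, then fall *)

(** Slopes weakly decrease from [L] to [U], so a rise at [k] forces rises everywhere before it, and
    after the first strict drop no slope is positive. Realness turns a failed rise into a strict
    drop. *)
Lemma ex_mode_of_shape (R : numDomainType) (p : {poly R}) (L U k : nat) :
  (forall i, p`_i \is Num.real) ->
  (forall i, (i < L)%N -> p`_i <= p`_i.+1) ->
  (forall i, (L <= i < U)%N -> p`_i.+2 - p`_i.+1 <= p`_i.+1 - p`_i) ->
  (forall i, (U <= i)%N -> p`_i.+1 <= p`_i) ->
  (L <= k <= U)%N -> (k < (size p).-1)%N -> p`_k <= p`_k.+1 ->
  exists k', is_mode p k' /\ (k < k')%N.
Proof.
move=> pr low mid high /andP [Lk kU] kn pk.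
have slope i j : (L <= i)%N -> (i <= j <= U)%N ->
    p`_j.+1 - p`_j <= p`_i.+1 - p`_i.
  move=> Li /andP [/subnKC <-]; elim: (j - i)%N => [|d IH]; first by rewrite addn0.
  rewrite addnS => h; apply: le_trans (IH (ltnW h)).
  by apply: mid; rewrite h andbT (leq_trans Li) ?leq_addr.
pose up j := (j <= (size p).-1)%N && all (fun i => p`_i <= p`_i.+1) (iota 0 j).
have upP j : reflect ((j <= (size p).-1)%N /\
    forall i, (i < j)%N -> p`_i <= p`_i.+1) (up j).
  apply: (iffP andP) => -[h1 h2]; split => //.
    by move=> i ij; apply: (allP h2); rewrite mem_iota.
  by apply/allP => i; rewrite mem_iota => /h2.
have upk : up k.+1.
  apply/upP; split => // i; rewrite ltnS => ik.
  have [/low //|Li] := ltnP i L.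
  by rewrite -subr_ge0 (le_trans _ (slope i k Li _)) ?subr_ge0 ?ik.
have upn j : up j -> (j <= (size p).-1)%N by case/andP.
case: (ex_maxnP (ex_intro up _ upk) upn) => k' upk' k'max.
have [k'n inc] := upP _ upk'.
exists k'; split; last exact: k'max.
split; last by move=> j [jn incj _]; apply: k'max; apply/upP.
split => // i /andP [k'i iltn].
have k'0 : p`_k'.+1 < p`_k'.
  rewrite real_ltNge ?pr //; apply/negP => hk'.
  suff /k'max : up k'.+1 by rewrite ltnn.
  apply/upP; split; first exact: leq_ltn_trans k'i iltn.
  by move=> j; rewrite ltnS leq_eqVlt => /predU1P [-> //|/inc].
have Lk' : (L <= k')%N.
  by rewrite leqNgt; apply/negP => /low h; have := lt_le_trans k'0 h; rewrite ltxx.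
have [/high //|/ltnW iU] := leqP U i.
rewrite -subr_le0 (le_trans (slope k' i Lk' _)) ?k'i // subr_le0.
exact: ltW.
Qed.

(** * Coefficients of products, in particular of [q (1+X)^b] *)

(** A summation range independent of [i] allows termwise comparison of coefficients of different
    index. *)
Lemma coefM_size (R : nzSemiRingType) (q r : {poly R}) (n i : nat) :
  (size q <= n)%N -> (n <= i.+1)%N ->
  (q * r)`_i = \sum_(j < n) q`_j * r`_(i - j).
Proof.
move=> qn ni; rewrite coefM.
rewrite -(big_mkord predT (fun j => q`_j * r`_(i - j))) (big_cat_nat (leq0n n) ni) /=.
rewrite big_mkord [X in _ + X]big_nat [X in _ + X]big1 ?addr0 // => j /andP [nj _].
by rewrite nth_default ?mul0r // (leq_trans qn).
Qed.

Lemma coefM_ge0 (R : numDomainType) (p q : {poly R}) :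
  (forall i, 0 <= p`_i) -> (forall i, 0 <= q`_i) -> forall i, 0 <= (p * q)`_i.
Proof. by move=> p0 q0 i; rewrite coefM sumr_ge0 // => j _; rewrite mulr_ge0. Qed.

Lemma coef_exp_ge0 (R : numDomainType) (p : {poly R}) n :
  (forall i, 0 <= p`_i) -> forall i, 0 <= (p ^+ n)`_i.
Proof.
move=> p0; elim: n => [|n IH] i; first by rewrite expr0 coef1 ler0n.
by rewrite exprS coefM_ge0.
Qed.

Section Profile.
Variables (q : {poly int}) (d b : nat).
Hypotheses (q_ge0 : forall i, 0 <= q`_i) (q_size : (size q <= d)%N).

(** The convolution at [i+1] has one extra term, [q_(i+1)]; this surplus later absorbs the
    subtracted coefficient of [p]. *)
Lemma coef_mulXD1n_step i : (i.*2 < b)%N ->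
  (q * ('X + 1) ^+ b)`_i + q`_i.+1 <= (q * ('X + 1) ^+ b)`_i.+1.
Proof.
move=> ib; rewrite !coefM [leRHS]big_ord_recr /= subnn coefXD1n bin0 mulr1.
rewrite lerD2r; apply: ler_sum => j _.
rewrite !coefXD1n ler_wpM2l // ler_nat.
rewrite subSn; last by rewrite -ltnS.
apply: bin_le_succ; rewrite mul2n.
by apply: leq_ltn_trans ib; rewrite leq_double leq_subr.
Qed.

Lemma coef_mulXD1n_ge i : (d <= i.+1)%N -> (b + 2 * d <= (2 * i).+3)%N ->
  (q * ('X + 1) ^+ b)`_i.+1 <= (q * ('X + 1) ^+ b)`_i.
Proof.
move=> di bi; rewrite !(coefM_size _ _ _ d) //; last by lia.
apply: ler_sum => j _; rewrite !coefXD1n ler_wpM2l // ler_nat.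
have jd := ltn_ord j.
by rewrite subSn; [apply: bin_ge_succ|]; lia.
Qed.

(** The middle indices [l = i-j+1] satisfy [|2l - b| <= 2d], and [8 d^2 <= b+2] puts [(2d)^2] within
    reach of [bin_concave]; nonnegative combinations keep concavity. *)
Lemma coef_mulXD1n_concave i : (d <= i.+1)%N ->
  (b <= 2 * i + 2)%N -> (2 * i.+1 <= b + 2 * d)%N -> (8 * d ^ 2 <= b + 2)%N ->
  (q * ('X + 1) ^+ b)`_i.+2 - (q * ('X + 1) ^+ b)`_i.+1 <=
  (q * ('X + 1) ^+ b)`_i.+1 - (q * ('X + 1) ^+ b)`_i.
Proof.
move=> di bi ib db; rewrite lerBlDr -addrAC lerBrDr.
rewrite !(coefM_size _ _ _ d) //; try by lia.
rewrite -!big_split /=; apply: ler_sum => j _.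
rewrite !coefXD1n -!mulrDr ler_wpM2l // -!natrD ler_nat.
have jd := ltn_ord j.
rewrite !subSn; try lia.
rewrite addnC addnn -mul2n; apply: bin_concave.
  have : (d <= d ^ 2)%N by rewrite -mulnn leq_pmulr // (leq_ltn_trans _ jd).
  by lia.
have u1 : 2 * (i - j).+1%:Z - b%:Z <= 2 * d%:Z by lia.
have u2 : - (2 * d%:Z) <= 2 * (i - j).+1%:Z - b%:Z by lia.
have : `|2 * (i - j).+1%:Z - b%:Z| ^+ 2 <= (2 * d%:Z) ^+ 2.
  by rewrite lerXn2r ?nnegrE // ler_norml u2.
by rewrite real_normK ?num_real //; lia.
Qed.

Lemma deriv_horner1 : q^`().[1] = \sum_(j < d) q`_j * j%:R.
Proof.
have sz : (size q^`() <= d)%N.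
  by exact: leq_trans (size_poly _ _) (leq_trans (leq_pred _) q_size).
rewrite (horner_coef_wide _ sz).
transitivity (\sum_(j < d.+1) q`_j * j%:R).
  rewrite big_ord_recl mulr0 add0r; apply: eq_bigr => j _.
  by rewrite expr1n mulr1 coef_deriv mulr_natr.
by rewrite big_ord_recr /= nth_default ?mul0r ?addr0.
Qed.

Lemma mul_bin_succ_diff l : (0 < l)%N ->
  b.+1%:Z * ('C(b, l)%:R - 'C(b, l.-1)%:R) =
  'C(b.+1, l)%:Z * (b.+1%:Z - 2 * l%:Z).
Proof.
case: l => // l _ /=.
have := mul_bin_diag b.+1 l; have := mul_bin_down b.+1 l.+1; rewrite /=.
have [lb|bl] := leqP l.+1 b.+1.
  have : (b.+1 - l.+1)%N%:Z = b%:Z - l%:Z by lia.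
  move: (b.+1 - l.+1)%N => u uE h1 h2.
  by rewrite !natz mulrBr -!PoszM h1 h2 !PoszM uE; lia.
by rewrite !bin_small; lia.
Qed.

(* With C(b+1, k-j) replaced by the central binomial W, the difference of the
   two coefficients is W (2 q'(1) - c q(1)) / (b+1); flatness of the binomial
   coefficients near the centre bounds the error by W q(1) c^3 / 2(b+1)^2. *)
Lemma coef_mulXD1n_peak (k c : nat) (P : int) :
  (d <= k)%N -> (2 * k = b.+1 + c)%N ->
  (k < b)%N -> (d <= c.+1)%N -> (2 * c ^ 3 <= b.+1)%N ->
  q.[1] <= 4 * P -> P <= 2 * q^`().[1] - c%:R * q.[1] ->
  (q * ('X + 1) ^+ b)`_k.-1 <= (q * ('X + 1) ^+ b)`_k.
Proof.
move=> dk kE kb dc cb qP Pq.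
(* As [2k = b+1+c], the factor [N - 2(k-j)] produced by [mul_bin_succ_diff] is [2j - c]. *)
pose N := b.+1; pose e (j : 'I_d) : int := 2 * (j : nat)%:Z - c%:Z.
rewrite -subr_ge0 -(pmulr_rge0 _ (_ : 0 < 2 * N%:Z * N%:Z)) //.
rewrite !(coefM_size _ _ _ d) //; try by lia.
rewrite -sumrB -[2 * _ * _ * _]mulrA mulr_sumr.
have -> : \sum_(j < d) N%:Z * (q`_j * (('X + 1) ^+ b)`_(k - j) -
      q`_j * (('X + 1) ^+ b)`_(k.-1 - j)) =
    \sum_(j < d) q`_j * ('C(N, k - j)%:Z * e j).
  apply: eq_bigr => j _; rewrite !coefXD1n -mulrBr mulrCA; congr (_ * _).
  have jd := ltn_ord j; have jk : (j < k)%N by lia.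
  have -> : (k.-1 - j = (k - j).-1)%N by lia.
  by rewrite mul_bin_succ_diff ?subn_gt0 // /e; congr (_ * _); lia.
have sq1 : q.[1] = \sum_(j < d) q`_j.
  rewrite (horner_coef_wide _ q_size); apply: eq_bigr => j _.
  by rewrite expr1n mulr1.
have sq' : 2 * q^`().[1] - c%:R * q.[1] = \sum_(j < d) q`_j * e j.
  rewrite deriv_horner1 sq1 !mulr_sumr -sumrB; apply: eq_bigr => j _.
  by rewrite /e natz; ring.
pose W : int := 'C(N, N./2)%:Z.
have W0 : 0 <= W by [].
have P0 : 0 <= P.
  have : 0 <= q.[1] by rewrite sq1 sumr_ge0.
  by lia.
(* This intermediate bound is nonnegative: [c^3 q(1) <= 4 c^3 P <= 2NP], and [P] is at most the sum
   of the [q_j e_j]. *)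
apply: (@le_trans _ _ (W * (2 * N%:Z * (\sum_(j < d) q`_j * e j)
                        - c%:Z ^+ 3 * \sum_(j < d) q`_j))).
  rewrite -sq' -sq1; apply: mulr_ge0 => //.
  have : c%:Z ^+ 3 * q.[1] <= c%:Z ^+ 3 * (4 * P) by apply: ler_wpM2l.
  have : 2 * c%:Z ^+ 3 * P <= N%:Z * P by apply: ler_wpM2r => //; rewrite /N; lia.
  have : N%:Z * P <= N%:Z * (2 * q^`().[1] - c%:R * q.[1]) by apply: ler_wpM2l.
  by move: (N%:Z * _) (c%:Z ^+ 3) => *; lia.
rewrite !mulr_sumr -sumrB !mulr_sumr; apply: ler_sum => j _.
have jd := ltn_ord j.
have kjN : (k - j <= N)%N by rewrite /N; lia.
have := bin_flat _ _ kjN; have := bin_le_half _ _ kjN.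
have -> : 2 * (k - j)%N%:Z - N%:Z = - e j by rewrite /e /N; lia.
have ec : `|e j| <= c%:Z by rewrite /e; lia.
rewrite sqrrN -/W; move: (e j) ec => x xc.
rewrite -(ler_nat int) !natz -/W; move: 'C(N, k - j)%:Z => C CW flat.
(* For [x >= 0] this is flatness multiplied by [x], with [x^3 <= c^3]; for [x <= 0] it suffices that
   [C <= W]. *)
suff h : W * (2 * N%:Z * x) - W * c%:Z ^+ 3 <= 2 * N%:Z * (C * x).
  have := ler_wpM2l (q_ge0 j) h; congr (is_true (_ <= _)); ring.
have c3 : 0 <= W * c%:Z ^+ 3 by rewrite mulr_ge0 ?exprn_ge0.
have [x0|/ltW x0] := lerP 0 x.
  have := ler_wpM2r x0 flat.
  have : W * x ^+ 3 <= W * c%:Z ^+ 3.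
    by rewrite ler_wpM2l // lerXn2r ?nnegrE // -[x]ger0_norm.
  move: (W * c%:Z ^+ 3) c3 => w _; rewrite !exprS expr0; lia.
have : N%:Z * (W * x) <= N%:Z * (C * x) by rewrite ler_wpM2l // ler_wnM2r.
by move: (W * c%:Z ^+ 3) c3 => w; lia.
Qed.
End Profile.

(** * Small cliques: values at 1 and location of the mode *)

(* (1 - 1/K)^K increases along K = 2^s and exceeds 1/3 at K = 8. *)
Lemma expn_le_3expn_pred s : (3 <= s)%N ->
  ((2 ^ s) ^ 2 ^ s <= 3 * (2 ^ s).-1 ^ 2 ^ s)%N.
Proof.
elim: s => // s IH; rewrite leq_eqVlt => /predU1P [[<-]|].
  by lia.
rewrite ltnS => /IH {IH}.
have K0 : (0 < 2 ^ s)%N by rewrite expn_gt0.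
rewrite expnS; move: (2 ^ s)%N K0 => K K0 h; rewrite !expnM.
have sq : ((4 * K * K.-1) ^ K <= ((2 * K).-1 ^ 2) ^ K)%N by rewrite leq_exp2r //; nia.
apply: (@leq_trans (3 * (4 * K * K.-1) ^ K)); last by rewrite leq_mul2l.
have -> : ((2 * K) ^ 2 = 4 * K * K)%N by ring.
by rewrite !expnMn mulnCA leq_mul2l h orbT.
Qed.

Lemma XD1E : ('X + 1 : {poly int}) = 'X - (-1)%:P.
Proof. by rewrite polyCN opprK. Qed.

Lemma size_XD1n (k : nat) : size (('X + 1 : {poly int}) ^+ k) = k.+1.
Proof. by rewrite XD1E size_exp_XsubC. Qed.

Lemma size_XD1n_sub1 (k : nat) : (size (('X + 1 : {poly int}) ^+ k - 1)%R <= k.+1)%N.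
Proof.
by apply: leq_trans (size_polyD _ _) _; rewrite geq_max size_polyN size_poly1 size_XD1n leqnn.
Qed.

Lemma size_XXD1n (k : nat) : size ('X * ('X + 1 : {poly int}) ^+ k) = k.+2.
Proof. by rewrite mulrC size_mulX ?size_XD1n // -size_poly_gt0 size_XD1n. Qed.

Section SmallCliques.
Variables s b : nat.
Let m := (2 ^ s)%N.
Let M := (m * s)%N.
Let p : {poly int} := (('X + 1) ^+ s - 1) ^+ m.
Let q : {poly int} := 'X * ('X + 1) ^+ M + p.

Lemma hitting_ge0 i : 0 <= p`_i.
Proof.
apply: coef_exp_ge0 => {}i; rewrite coefB coefXD1n coef1.
by case: i => [|i]; rewrite ?bin0 ?subrr ?subr0.
Qed.

Lemma size_hitting : (size p <= M.+1)%N.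
Proof.
apply: leq_trans (size_poly_exp_leq _ _) _; rewrite ltnS /M mulnC leq_mul2l.
by rewrite -subn1 leq_subLR add1n size_XD1n_sub1 orbT.
Qed.

Lemma hitting_le i : p`_i <= q`_i.
Proof.
by rewrite coefD lerDr coefXM; case: ifP; rewrite ?coefXD1n.
Qed.

Lemma q_size : (size q <= M.+2)%N.
Proof.
apply: leq_trans (size_polyD _ _) _; rewrite geq_max (leqW size_hitting) andbT.
by rewrite size_XXD1n.
Qed.

Lemma size_dom_factor :
  size ('X * ('X + 1) ^+ (M + b) + p * (('X + 1) ^+ b - 1)) = (M + b).+2.
Proof.
rewrite size_polyDl size_XXD1n //; apply: leq_ltn_trans (size_polyMleq _ _) _.
have := leq_add size_hitting (size_XD1n_sub1 b).
by move: (_ + _)%N => t; rewrite /M /m; lia.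
Qed.

Lemma natz_expn (x k : nat) : (x%:Z) ^+ k = (x ^ k)%N%:Z.
Proof. by rewrite -!natz natrX. Qed.

(** A pair of equations, so that one rewrite evaluates both powers of [1 + X] at 1. *)
Lemma two_expnE : ((1 + 1 : int) ^+ s = m%:Z) * ((1 + 1 : int) ^+ M = (m ^ m)%N%:Z).
Proof.
have -> : (1 + 1 : int) = 2%N%:Z by [].
by rewrite !natz_expn /M /m mulnC expnM.
Qed.

Lemma two_expn_sub1 : (m%:Z - 1) = m.-1%:Z.
Proof. by have : (0 < m)%N by [rewrite expn_gt0]; lia. Qed.

Lemma q_horner1 : q.[1] = (m ^ m)%N%:Z + (m.-1 ^ m)%N%:Z.
Proof.
rewrite /q /p !(hornerE, horner_exp) /= !two_expnE two_expn_sub1.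
by rewrite natz_expn.
Qed.

Lemma q_deriv_horner1 : 2 * q^`().[1] =
  (M + 2)%N%:Z * (m ^ m)%N%:Z + (M * m * m.-1 ^ m.-1)%N%:Z.
Proof.
have twoX k : 2 * ((1 + 1 : int) ^+ k.-1 *+ k) = k%:Z * (1 + 1) ^+ k.
  by case: k => [|k]; rewrite ?mulr0n ?mulr0 ?mul0r // -mulr_natl natz exprS; ring.
rewrite /q /p derivD derivM derivX !(deriv_exp, derivE) !(hornerE, horner_exp, hornerMn) /=.
rewrite -[_ *+ m]mulr_natl natz mulrDr mulrDr twoX.
rewrite mulrCA [2 * (_ * _)]mulrA twoX !two_expnE two_expn_sub1 natz_expn.
by rewrite /M !PoszM PoszD; ring.
Qed.

Lemma dom_factorE : 'X * ('X + 1) ^+ (M + b) + p * (('X + 1) ^+ b - 1) =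
  q * ('X + 1) ^+ b - p.
Proof. by rewrite exprD /q; ring. Qed.

(** Put [A = m^m] and [P = (m-1)^m]. Since [M m (m-1)^(m-1) >= (M+s) P], the right side is at least
    [(2-kap) A + (s-kap) P]. For [kap >= 2], [A <= 3P] makes this at least [(s+6-4kap) P], whence
    the condition [4kap <= s+5]. *)
Lemma q_drift kap : (3 <= s)%N -> (0 < kap)%N -> (4 * kap <= s + 5)%N ->
  (m.-1 ^ m)%N%:Z <= 2 * q^`().[1] - (M + kap)%N%:R * q.[1].
Proof.
move=> s3 kap0 kaps; rewrite q_deriv_horner1 q_horner1 natz.
have := expn_le_3expn_pred _ s3; rewrite -/m.
have : (m.-1 ^ m = m.-1 ^ m.-1 * m.-1)%N.
  by rewrite -expnSr prednK // expn_gt0.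
have : ((M + s) * m.-1 <= M * m)%N.
  have -> : M = (m * s)%N by [].
  have : (0 < m)%N by rewrite expn_gt0.
  by case: (m) => // r _ /=; nia.
move: (m ^ m)%N (m.-1 ^ m)%N (m.-1 ^ m.-1)%N => A P Q MQ PE A3P.
have h : ((M + s) * P <= M * m * Q)%N.
  by rewrite PE [(Q * _)%N]mulnC mulnA leq_mul2r MQ orbT.
have hA : ((kap - 2) * A <= (kap - 2) * (3 * P))%N by rewrite leq_mul2l A3P orbT.
move: (M * m * Q)%N h => Z h.
have h1 : ((M + s)%N * P)%N%:Z <= Z%:Z by [].
(* For [kap = 1] the coefficient of [A] is positive and [A <= 3P] is of no help. *)
have [k1|k2] := leqP kap 1.
  have -> : kap = 1%N by lia.
  have : (P + P <= s * P)%N by nia.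
  by move: h1; rewrite !PoszM !PoszD; nia.
have : ((4 * kap) * P <= (s + 5) * P)%N by rewrite leq_mul2r kaps orbT.
have [r kE] : exists r, kap = r.+2 by exists (kap - 2)%N; lia.
move: h1 hA; rewrite kE !subSS subn0 => h1 hA h2.
by lia.
Qed.

(** The graph has [n = M+b+1] vertices, so [k = (n+kap)/2]. The subtracted [p] has degree at most
    [M < b/2] and affects only the rising range. *)
Lemma clique_cone_mode kap k : (3 <= s)%N -> (0 < kap)%N ->
  (4 * kap <= s + 5)%N -> (2 * k = b.+1 + (M + kap))%N ->
  (2 * (M + kap) ^ 3 <= b.+1)%N ->
  exists k', is_mode (dom_poly (cone _ _ ord_max (block m s b))) k' /\ (k <= k')%N.
Proof.
move=> s3 kap0 kaps kE bM.
have m8 : (8 <= m)%N by rewrite -[8%N]/(2 ^ 3)%N leq_exp2l.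
have M24 : (24 <= M)%N by rewrite /M -[24%N]/(8 * 3)%N leq_mul.
have kapM : (kap <= M)%N by rewrite /M; nia.
have bM1 : (2 * (M + 1) ^ 3 <= b.+1)%N.
  by apply: leq_trans bM; rewrite leq_mul2l leq_exp2r //; lia.
(* From [M >= 24], [2(M+1) >= 50]: the cubic hypothesis yields the quadratic bound that concavity
   needs with [d = M+2]. *)
have bx : (50 * (M + 1) ^ 2 <= b.+1)%N.
  apply: leq_trans bM1; rewrite [((M + 1) ^ 3)%N]expnS mulnA leq_mul2r.
  by apply/orP; right; lia.
have bM2 : (8 * M.+2 ^ 2 <= b + 2)%N.
  have : (M.+2 ^ 2 <= (2 * (M + 1)) ^ 2)%N by rewrite leq_exp2r //; lia.
  by rewrite expnMn; lia.
have bM3 : (4 * M + 20 <= b)%N.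
  have : (M + 1 <= (M + 1) ^ 2)%N by rewrite -mulnn leq_pmulr // addn1.
  by lia.
have b0 : (0 < b)%N by lia.
have s0 : (0 < s)%N by lia.
 rewrite dom_poly_clique_cone // dom_factorE.
have sz := size_dom_factor; rewrite dom_factorE in sz.
have q0 i : 0 <= q`_i by apply: le_trans (hitting_ge0 i) (hitting_le i).
have pM i : (M < i)%N -> p`_i = 0.
  by move=> Mi; rewrite nth_default // (leq_trans size_hitting).
have DF i : (M < i)%N -> (q * ('X + 1) ^+ b - p)`_i = (q * ('X + 1) ^+ b)`_i.
  by move=> Mi; rewrite coefB pM ?subr0.
(* The rise from [k-1] to [k] already gives a mode of at least [k]. *)
suff : exists k', is_mode (q * ('X + 1) ^+ b - p) k' /\ (k.-1 < k')%N.
  by case=> k' [h1 h2]; exists k'; split=> //; lia.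
(* Below the first bound [2i < b]; from the second on, every index [i-j] with [j < M+2] satisfies
   [b <= 2(i-j)+1]. *)
apply: (@ex_mode_of_shape _ _ b.+1./2 (b + 2 * M + 2)./2).
- by move=> i; rewrite num_real.
- move=> i ib; rewrite !coefB.
  have /(coef_mulXD1n_step q b q0) step : (i.*2 < b)%N by lia.
  rewrite lerBlDr addrAC lerBrDr (le_trans (lerD (lexx _) (hitting_le i.+1))) //.
  by rewrite (le_trans step) // lerDl hitting_ge0.
- move=> i /andP [i1 i2]; rewrite !DF; try by lia.
  by apply: (coef_mulXD1n_concave _ _ _ q0 q_size); lia.
- move=> i i1; rewrite !DF; try by lia.
  by apply: (coef_mulXD1n_ge _ _ _ q0 q_size); lia.
- by lia.
- by rewrite sz /=; lia.
rewrite prednK; last by lia.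
rewrite !DF; try by lia.
(* The choice [P = p(1)] works since [q(1) = m^m + P <= 4P]. *)
apply: (coef_mulXD1n_peak _ _ _ q0 q_size k (M + kap) (m.-1 ^ m)%N%:Z) => //; try by lia.
  rewrite q_horner1; have := expn_le_3expn_pred _ s3; rewrite -/m; lia.
exact: q_drift.
Qed.
End SmallCliques.

(** * Choice of parameters *)

Lemma cube_le_4expn s : (3 <= s)%N -> (s ^ 3 <= (2 ^ s) ^ 2)%N.
Proof.
elim: s => // s IH; rewrite leq_eqVlt => /predU1P [[<-] //|].
rewrite ltnS => s3; have := IH s3; rewrite [(2 ^ s.+1)%N]expnS; move: (2 ^ s)%N => K.
rewrite expnMn => h; apply: leq_trans (_ : 4 * s ^ 3 <= _)%N; last first.
  by rewrite leq_mul2l h orbT.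
have h1 : (3 * s <= s * s)%N by rewrite leq_mul2r s3 orbT.
have h2 : (3 * (s * s) <= s * (s * s))%N by rewrite leq_mul2r s3 orbT.
by lia.
Qed.

(** With [K = 2^s], [s^3 <= K^2] bounds [(s(K+1))^3] by [2K^5]. The left side is then at most
    [5K^5], below [32K^5]; hence the exponent 5. *)
Lemma clique_cone_room s kap : (3 <= s)%N -> (kap <= s)%N ->
  (2 * (2 ^ s * s + kap) ^ 3 + 2 ^ s * s <= 2 ^ (5 * s.+1))%N.
Proof.
move=> s3 kaps.
have K8 : (8 <= 2 ^ s)%N by rewrite -[8%N]/(2 ^ 3)%N leq_exp2l.
have sK : (s <= 2 ^ s)%N by rewrite ltnW // ltn_expl.
rewrite mulnS expnD [(5 * s)%N]mulnC [in leqRHS]expnM -[(2 ^ 5)%N]/32%N.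
have := cube_le_4expn s s3; move: (2 ^ s)%N K8 sK => K K8 sK s3K.
have h1 : ((K * s + kap) ^ 3 <= (s * K.+1) ^ 3)%N.
  by rewrite leq_exp2r // mulnS mulnC addnC leq_add2r.
have h2 : (K.+1 ^ 3 <= 2 * K ^ 3)%N.
  have : ((4 * K.+1) ^ 3 <= (5 * K) ^ 3)%N by rewrite leq_exp2r //; lia.
  by rewrite !expnMn; lia.
have h3 : ((s * K.+1) ^ 3 <= 2 * K ^ 5)%N.
  have -> : (2 * K ^ 5 = K ^ 2 * (2 * K ^ 3))%N by rewrite mulnCA -expnD.
  by rewrite expnMn leq_mul.
have h4 : (K * s <= K ^ 5)%N.
  apply: (@leq_trans (K ^ 2)); first by rewrite -mulnn leq_mul.
  by rewrite leq_pexp2l //; lia.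
by lia.
Qed.

Theorem theorem1p3 (R : realType) (n : nat) (hn : (2 ^ 20 <= n)%N) :
  exists G : simple_graph 'I_n,
    (exists v : 'I_n, universal G v) /\
    (exists k : nat, is_mode (dom_poly G) k /\
       (n%:R / 2 + 1 / 999 * (ln n%:R / ln 2) <= k%:R :> R)).
Proof.
(* Here [s+1] is the integer part of [(log_2 n)/5], and [n >= 2^20] gives [s >= 3]. *)
have [s [s3 ns ns']] : exists s, [/\ (3 <= s)%N, (2 ^ (5 * s.+1) <= n)%N
    & (n < 2 ^ (5 * s.+2))%N].
  have n0 : (0 < n)%N by apply: leq_trans hn; rewrite expn_gt0.
  have L20 : (20 <= trunc_log 2 n)%N by apply: trunc_log_max.
  exists (trunc_log 2 n %/ 5).-1.
  have := trunc_logP (isT : 1 < 2)%N n0.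
  have := trunc_log_ltn n (isT : 1 < 2)%N.
  move: (trunc_log 2 n) L20 => L L20 h1 h2; split; first by lia.
    by apply: leq_trans h2; rewrite leq_exp2l //; lia.
  by apply: leq_trans h1 _; rewrite leq_exp2l //; lia.
(* Take [t] the integer part of [(s+1)/4] and [kap] either [t] or [t+1], with the parity of [n]. As
   [log_2 n < 5(s+2)], [10(s+2) <= 999t] yields [kap/2 >= (log_2 n)/999]. *)
have [t [kap [k [ts kapt kaps kE]]]] : exists t kap k,
    [/\ (10 * s.+2 <= 999 * t)%N, (t <= kap)%N, (4 * kap <= s + 5)%N
      & (2 * k = n + kap)%N].
  exists (s.+1 %/ 4)%N; exists (s.+1 %/ 4 + odd (n + s.+1 %/ 4))%N.
  exists ((n + (s.+1 %/ 4 + odd (n + s.+1 %/ 4)))./2)%N.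
  move: (s.+1 %/ 4)%N (divn_eq s.+1 4) (ltn_pmod s.+1 (isT : 0 < 4)%N) => r.
  by split; lia.
have kap_s : (kap <= s)%N by lia.
have room := leq_trans (clique_cone_room s kap s3 kap_s) ns.
have [b nE] : exists b, n = (2 ^ s * s + b).+1.
  have : (0 < (2 ^ s * s + kap) ^ 3)%N by rewrite expn_gt0; lia.
  by exists (n - (2 ^ s * s).+1)%N; lia.
rewrite {}nE {hn ns} in ns' kE room *.
have [||||k' [modek' kk']] := clique_cone_mode s b kap k s3; try by lia.
exists (cone _ _ ord_max (block (2 ^ s) s b)); split.
  by exists ord_max; apply: universal_cone.
exists k'; split=> //; move: ((2 ^ s * s + b).+1)%N (ltn0Sn (2 ^ s * s + b)) ns' kE => N N0 ns' kE.
have ln2 : 0 < ln 2 :> R by rewrite ln_gt0 // ltr1n.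
have lnN : ln N%:R / ln 2 <= (5 * s.+2)%N%:R :> R.
  rewrite ler_pdivrMr // mulr_natl -lnXn // -natrX ler_ln ?posrE ?ltr0n ?expn_gt0 //.
  by rewrite ler_nat ltnW.
have h1 : 2 * k%:R = N%:R + kap%:R :> R by rewrite -natrD -kE natrM.
have h2 : 2 * (5 * s.+2)%N%:R <= 999 * kap%:R :> R by rewrite -!natrM ler_nat; lia.
have h3 : k%:R <= k'%:R :> R by rewrite ler_nat.
by lra.
Qed.
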